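(* Let $u:\mathbb{Z}\to\mathbb{R}$ be finitely supported with $u(0)=0$. Then for every positive integer $k$, $$\sum_{n \in \mathbb{Z}}|u(n)-u(n-1)|^2 \Big(n-\frac{1}{2}\Big)^{2k} \geq \sum_{i=1}^k \gamma_i^k \sum_{n \in \mathbb{Z}} |u(n)|^2 n^{2k-2i}+2^{-2k-2}\sum_{n \in \mathbb{Z}\setminus\{0\}} \frac{|u(n)|^2}{n^2},$$ where the constants $\gamma_i^k$ ($1\le i\le k$), which are non-negative, are given by $$2^{2i}\gamma_i^k := 2\binom{2k}{2i} - 2\binom{k}{i} + \binom{k}{i-1}.$$
   Context: $\binom{x}{y}=\frac{\Gamma(x+1)}{\Gamma(x-y+1)\Gamma(y+1)}$ is the usual binomial coefficient (here with integer arguments). The convention $n^0=1$ is used for all $n$. *)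

(* Defs.v *)
From mathcomp Require Export all_boot all_order all_algebra.
From mathcomp Require Export boolp classical_sets cardinality fsbigop reals.

Set Implicit Arguments.
Unset Strict Implicit.
Unset Printing Implicit Defensive.

Import Order.TTheory GRing.Theory Num.Theory.
Local Open Scope classical_set_scope.
Local Open Scope ring_scope.

Definition finitely_supported (R : realType) (u : int -> R) : Prop :=
  finite_set [set n : int | u n <> 0].

(* Meant for [1 <= i <= k]; [i.-1] is truncated at [i = 0]. *)
Definition gamma (R : realType) (k i : nat) : R :=
  (2 * 'C(2 * k, 2 * i)%:R - 2 * 'C(k, i)%:R + 'C(k, i.-1)%:R) / 2 ^+ (2 * i).

(* Main.v *)
Require Import Defs.
From mathcomp Require Import finmap ring lra zify.

Set Implicit Arguments.
Unset Strict Implicit.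

Import Order.TTheory GRing.Theory Num.Theory.
Local Open Scope classical_set_scope.
Local Open Scope ring_scope.

(** The inequality is proved one edge {n-1, n} at a time.  Expanding the square
on the left produces, at each vertex n, the weight
(n - 1/2)^(2k) + (n + 1/2)^(2k) in front of u(n)^2, minus the cross terms
2 (n - 1/2)^(2k) u(n) u(n-1).

The key is the function g(t) = (t^2 + 1/4)^k.  The binomial theorem shows that
the right-hand side is exactly the sum over n <> 0 of
  [(n - 1/2)^(2k) + (n + 1/2)^(2k) - (2 - 1/(4 n^2)) g(n)] u(n)^2
(lemma [gamma_sumE]; the term 2^(-2k-2) / n^2 completes the binomial expansion
of g(n) / (4 n^2)).  What remains is to bound the sum of the cross terms by the
sum of (2 - 1/(4 n^2)) g(n) u(n)^2.

Since (t^2 + 1/4) ((t+1)^2 + 1/4) = (t + 1/2)^4 + 1/4, the edge weight is at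
most the geometric mean of g at the two ends.  In terms of v = sqrt(g) |u| the
claim thus follows from the discrete Hardy inequality
  sum (v(n) - v(n-1))^2 >= sum v(n)^2 / (4 n^2),
with v(0) = 0.  This is proved, without taking square roots, by distributing
each cross term over the two ends of its edge with reciprocal factors
phi(m)/phi(m+1) and phi(m+1)/phi(m), m and m + 1 being the distances of the
ends from 0 ([cross_term_edge]), where phi(m) = m binom(2m, m) / 4^m.  This
phi behaves like sqrt(m) and has rational ratios; the factors that meet at a
vertex add up to 2 - 1/(2m (2m - 1)), which is at most 2 - 1/(4 m^2)
([weights_le]).  The half-lines n > 0 and n < 0 do not interact because
u(0) = 0, and each is the mirror image of the other.

The constants gamma are non-negative because binom(k, i) is at most
binom(2k, 2i). *)

(** * Non-negativity of the constants *)

(** In the Vandermonde expansion of binom(k + k, 2i), the middle term is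
binom(k, i)^2. *)
Lemma leq_bin_double k i : ('C(k, i) <= 'C(2 * k, 2 * i))%N.
Proof.
have [ik|ki] := leqP i k; last by rewrite bin_small.
have i_lt : (i < (2 * i).+1)%N by rewrite mul2n -addnn ltnS leq_addr.
rewrite [(2 * k)%N]mul2n -addnn -binomial.Vandermonde (bigD1 (Ordinal i_lt)) //=.
have -> : (2 * i - i = i)%N by rewrite mul2n -addnn addnK.
apply: leq_trans (leq_addr _ _).
by rewrite leq_pmulr // bin_gt0.
Qed.

Lemma gamma_ge0 (R : realType) k i : 0 <= gamma R k i.
Proof.
apply: divr_ge0; last by rewrite exprn_ge0.
rewrite addr_ge0 ?ler0n // subr_ge0 ler_pM2l ?ltr0n //.
by rewrite ler_nat leq_bin_double.
Qed.

(** * The cross term of one edge *)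

Section EdgeInequality.
Variable R : realFieldType.
Implicit Types a b w x y t : R.

(** The form a x^2 - 2 w x y + b y^2 has determinant a b - w^2 >= 0 and
a > 0, hence is positive semidefinite. *)
Lemma cross_term_le a b w x y :
  0 < a -> w ^+ 2 <= a * b -> 2 * w * x * y <= a * x ^+ 2 + b * y ^+ 2.
Proof.
move=> a0 wab; rewrite -(ler_pM2l a0) -subr_ge0.
have -> : a * (a * x ^+ 2 + b * y ^+ 2) - a * (2 * w * x * y) =
  (a * x - w * y) ^+ 2 + (a * b - w ^+ 2) * y ^+ 2 by ring.
by rewrite addr_ge0 ?sqr_ge0 // mulr_ge0 ?sqr_ge0 // subr_ge0.
Qed.

Definition quarter_pow (k : nat) (t : R) : R := (t ^+ 2 + 1 / 4) ^+ k.

Lemma quarter_pow_gt0 k t : 0 < quarter_pow k t.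
Proof. by rewrite exprn_gt0 //; have := sqr_ge0 t; lra. Qed.

Lemma quarter_powN k t : quarter_pow k (- t) = quarter_pow k t.
Proof. by rewrite /quarter_pow sqrrN. Qed.

(** With m = t + 1/2, the two factors are m^2 + 1/2 + m and m^2 + 1/2 - m, so
that their product is m^4 + 1/4. *)
Lemma midpoint_sqr_le k t :
  ((t + 1 / 2) ^+ (2 * k)) ^+ 2 <= quarter_pow k (t + 1) * quarter_pow k t.
Proof.
rewrite exprM -exprM mulnC exprM -exprMn /quarter_pow.
apply: lerXn2r; rewrite ?nnegrE ?sqr_ge0 //.
  by rewrite mulr_ge0 // addr_ge0 ?sqr_ge0 // divr_ge0.
have -> : ((t + 1) ^+ 2 + 1 / 4) * (t ^+ 2 + 1 / 4) =
  ((t + 1 / 2) ^+ 2) ^+ 2 + 1 / 4 by field.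
by rewrite lerDl divr_ge0.
Qed.

(** The factors 1 - 1/(2t + 1) = 2t/(2t + 1) and 1 + 1/(2t) = (2t + 1)/(2t) are
reciprocal: they are the ratios of phi(m) = m binom(2m, m) / 4^m at t and
t + 1. *)
Lemma cross_term_edge k t x y : 0 < t ->
  2 * (t + 1 / 2) ^+ (2 * k) * x * y <=
  (1 - 1 / (2 * t + 1)) * quarter_pow k (t + 1) * x ^+ 2 +
  (1 + 1 / (2 * t)) * quarter_pow k t * y ^+ 2.
Proof.
move=> t0; have t2 : 0 < 2 * t + 1 by lra.
apply: cross_term_le.
  rewrite mulr_gt0 ?quarter_pow_gt0 // subr_gt0 div1r invf_lt1 //; lra.
apply: (le_trans (midpoint_sqr_le k t)).
rewrite mulrACA [X in _ <= X * _](_ : _ = 1) ?mul1r //.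
by field; rewrite !gt_eqF.
Qed.

End EdgeInequality.

(** * The binomial identity for the vertex weights *)

Lemma sum_even_terms (V : nmodType) (f : nat -> V) k :
  (forall j, odd j -> f j = 0) ->
  \sum_(j < (2 * k).+1) f j = \sum_(i < k.+1) f (2 * i)%N.
Proof.
move=> f_odd; elim: k => [|k IHk]; first by rewrite muln0 !big_ord1.
have two_succ : (2 * k.+1 = (2 * k).+2)%N by rewrite mulnS.
rewrite two_succ 2!big_ord_recr [RHS]big_ord_recr /= IHk two_succ.
by rewrite f_odd ?addr0 //= mul2n odd_double.
Qed.

Lemma sum_half_shift_powers (R : realFieldType) k (x : R) :
  (x - 1 / 2) ^+ (2 * k) + (x + 1 / 2) ^+ (2 * k) =
  \sum_(i < k.+1) 2 * 'C(2 * k, 2 * i)%:R / 2 ^+ (2 * i)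
    * x ^+ (2 * k - 2 * i).
Proof.
pose f j := x ^+ (2 * k - j) * ((- (1 / 2)) ^+ j + (1 / 2) ^+ j)
   * 'C(2 * k, j)%:R.
rewrite !exprDn -big_split /=.
transitivity (\sum_(j < (2 * k).+1) f j).
  by apply: eq_bigr => j _; rewrite /f mulrDr mulrDl !mulr_natr.
rewrite sum_even_terms.
  apply: eq_bigr => i _; rewrite /f exprNn exprM sqrrN !expr1n mul1r.
  rewrite expr_div_n expr1n; field.
  by rewrite expf_neq0 // pnatr_eq0.
by move=> j oddj; rewrite /f exprNn -signr_odd oddj expr1 mulN1r addNr mulr0 mul0r.
Qed.

Lemma quarter_pow_expand (R : realFieldType) k (x : R) :
  quarter_pow k x = \sum_(i < k.+1) 'C(k, i)%:R / 2 ^+ (2 * i) * x ^+ (2 * k - 2 * i).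
Proof.
rewrite /quarter_pow exprDn; apply: eq_bigr => i _.
rewrite -mulr_natr -mulnBr -exprM expr_div_n expr1n [2 ^+ (2 * i)]exprM.
have -> : (2 ^+ 2 : R) = 4 by ring.
by ring.
Qed.

(** The three binomial coefficients in gamma produce the three parts of the
right-hand side: binom(2k, 2i) the two half-shifted powers, binom(k, i) the
term 2 (x^2 + 1/4)^k, and binom(k, i-1) the term (x^2 + 1/4)^k / (4 x^2).  The
first two have the same leading term 2 x^(2k), which cancels; the third lacks
only its last term, which is the one added on the left. *)
Lemma gamma_sumE (R : realType) k (x : R) : x != 0 ->
  \sum_(1 <= i < k.+1) gamma R k i * x ^+ (2 * k - 2 * i)
    + 2 ^- (2 * k + 2) / x ^+ 2 =
  (x - 1 / 2) ^+ (2 * k) + (x + 1 / 2) ^+ (2 * k)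
    - (2 - 1 / (4 * x ^+ 2)) * quarter_pow k x.
Proof.
move=> x0; have x20 : x ^+ 2 != 0 by rewrite expf_neq0.
pose a i := 2 * 'C(2 * k, 2 * i)%:R / 2 ^+ (2 * i) * x ^+ (2 * k - 2 * i) : R.
pose b i := 'C(k, i)%:R / 2 ^+ (2 * i) * x ^+ (2 * k - 2 * i) : R.
have -> : \sum_(1 <= i < k.+1) gamma R k i * x ^+ (2 * k - 2 * i) =
  \sum_(i < k) (a i.+1 - 2 * b i.+1 + b i / (4 * x ^+ 2)).
  rewrite big_add1 big_mkord /=; apply: eq_bigr => i _.
  rewrite /a /b /gamma /=.
  (* gamma_(i+1) uses binom(k, i), whose natural power of x is x^2 times the
     power that it multiplies here; dividing by x^2 compensates. *)
  have -> : (2 * k - 2 * i = 2 + (2 * k - 2 * i.+1))%N by case: i => i /= ?; lia.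
  rewrite !mulnS !exprD; field.
  by rewrite x0 expf_neq0 ?pnatr_eq0.
have sum_a : (x - 1 / 2) ^+ (2 * k) + (x + 1 / 2) ^+ (2 * k) =
  2 * b 0%N + \sum_(i < k) a i.+1.
  rewrite sum_half_shift_powers big_ord_recl /=; congr (_ + _).
  by rewrite /b !muln0 !bin0 expr0; ring.
have sum_b_low : quarter_pow k x = b 0%N + \sum_(i < k) b i.+1.
  by rewrite quarter_pow_expand big_ord_recl.
have sum_b_high : quarter_pow k x = \sum_(i < k) b i + b k.
  by rewrite quarter_pow_expand big_ord_recr.
have b_last : b k / (4 * x ^+ 2) = 2 ^- (2 * k + 2) / x ^+ 2.
  rewrite /b binn subnn expr0 exprD; field.
  by rewrite x0 expf_neq0 ?pnatr_eq0.
rewrite -b_last big_split sumrB /= -mulr_sumr -mulr_suml sum_a.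
rewrite [(2 - _) * _]mulrBl {1}sum_b_low sum_b_high.
by field.
Qed.

(** * Distribution of the energy of each edge over its two ends *)

Section HardyEdges.
Variables (R : realType) (k : nat) (u : int -> R).
Hypothesis u0 : u 0 = 0.

(** The factor given by [cross_term_edge] to the end n of the edge {n-1, n}: the
far end when n > 0, and the near end, at distance - n from 0, otherwise. *)
Definition head_weight (n : int) : R :=
  if (0 < n)%R then 1 - 1 / (2 * n%:~R - 1) else 1 - 1 / (2 * n%:~R).

(** The factor given to the other end, n - 1. *)
Definition tail_weight (n : int) : R :=
  if (0 < n)%R then 1 + 1 / (2 * n%:~R - 2) else 1 + 1 / (2 * n%:~R - 1).

Lemma cross_term_int_edge (n : int) :
  2 * (n%:~R - 1 / 2) ^+ (2 * k) * u n * u (n - 1) <=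
  head_weight n * quarter_pow k n%:~R * u n ^+ 2 +
  tail_weight n * quarter_pow k (n%:~R - 1) * u (n - 1) ^+ 2.
Proof.
rewrite /head_weight /tail_weight; case: ltrP => n0.
  (* At an edge touching 0 the cross term vanishes, so any non-negative factor
     at the other end will do; here that factor is 0. *)
  have [->|n1] := eqVneq n 1.
    rewrite subrr u0 !mulr0 expr0n mulr0 addr0.
    apply: mulr_ge0 (sqr_ge0 _); apply: mulr_ge0.
      have -> : 2 * 1%:~R - 1 = 1 :> R by ring.
      by rewrite divr1 subrr.
    exact/ltW/quarter_pow_gt0.
  have n1' : 0 < (n%:~R - 1 : R).
    by rewrite subr_gt0 ltr1z; lia.
  have := cross_term_edge k (u n) (u (n - 1)) n1'.
  rewrite subrK.
  have -> : n%:~R - 1 + 1 / 2 = n%:~R - 1 / 2 :> R by field.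
  have -> : 2 * (n%:~R - 1) + 1 = 2 * n%:~R - 1 :> R by ring.
  by have -> : 2 * (n%:~R - 1) = 2 * n%:~R - 2 :> R by ring.
(* By reflection, n - 1 is now the far end of the edge. *)
have [->|n1] := eqVneq n 0.
  rewrite u0 mulr0 mul0r expr0n mulr0 add0r.
  apply: mulr_ge0 (sqr_ge0 _); apply: mulr_ge0.
    have -> : 2 * 0%:~R - 1 = -1 :> R by ring.
    by rewrite div1r invrN1 subrr.
  exact/ltW/quarter_pow_gt0.
have n1' : 0 < (- n%:~R : R).
  by rewrite oppr_gt0 ltrz0; lia.
have := cross_term_edge k (u (n - 1)) (u n) n1'.
have -> : - n%:~R + 1 / 2 = - (n%:~R - 1 / 2) :> R by field.
have -> : - n%:~R + 1 = - (n%:~R - 1) :> R by ring.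
rewrite !quarter_powN exprM sqrrN -exprM.
have -> : 2 * - n%:~R + 1 = - (2 * n%:~R - 1) :> R by ring.
rewrite mulrN !invrN !mulrN.
by rewrite opprK => le_xy; rewrite [leRHS]addrC mulrAC.
Qed.

(** With m = |n|, the sum is 2 - 1/(2m (2m - 1)) on both half-lines. *)
Lemma weights_le (n : int) : n != 0 ->
  head_weight n + tail_weight (n + 1) <= 2 - 1 / (4 * n%:~R ^+ 2).
Proof.
rewrite /head_weight /tail_weight => n0; case: ltrP => n_pos.
  have n1 : 1 <= n%:~R :> R by rewrite ler1z; lia.
  rewrite ifT; last by lia.
  have den_le : 4 * n%:~R ^+ 2 - 2 * n%:~R <= 4 * n%:~R ^+ 2 :> R by lra.
  have den_gt0 : 0 < 4 * n%:~R ^+ 2 - 2 * n%:~R :> R by nra.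
  have -> : 1 - 1 / (2 * n%:~R - 1) + (1 + 1 / (2 * (n + 1)%:~R - 2)) =
    2 - 1 / (4 * n%:~R ^+ 2 - 2 * n%:~R) :> R.
    by rewrite intrD; field; rewrite !gt_eqF; lra.
  by rewrite lerD2l lerN2 !div1r lef_pV2 ?posrE //; lra.
have n1 : n%:~R <= -1 :> R by rewrite -[-1]mulrN1z ler_int; lia.
rewrite ifF; last by lia.
have den_le : 4 * n%:~R ^+ 2 + 2 * n%:~R <= 4 * n%:~R ^+ 2 :> R by lra.
have den_gt0 : 0 < 4 * n%:~R ^+ 2 + 2 * n%:~R :> R by nra.
have -> : 1 - 1 / (2 * n%:~R) + (1 + 1 / (2 * (n + 1)%:~R - 1)) =
  2 - 1 / (4 * n%:~R ^+ 2 + 2 * n%:~R) :> R.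
  rewrite intrD; field.
  by apply/and3P; split; first exact: lt0r_neq0; apply: ltr0_neq0; lra.
by rewrite lerD2l lerN2 !div1r lef_pV2 ?posrE //; lra.
Qed.

(** The share of the vertex n in the energy of the edge {n-1, n}; [tail_energy]
is its share in the energy of the next edge {n, n+1}, whence the index n + 1
of the weight there. *)
Definition head_energy (n : int) : R :=
  ((n%:~R - 1 / 2) ^+ (2 * k) - head_weight n * quarter_pow k n%:~R) * u n ^+ 2.

Definition tail_energy (n : int) : R :=
  ((n%:~R + 1 / 2) ^+ (2 * k) - tail_weight (n + 1) * quarter_pow k n%:~R)
    * u n ^+ 2.

Lemma edge_energy_ge (n : int) :
  head_energy n + tail_energy (n - 1) <=
  `|u n - u (n - 1)| ^+ 2 * (n%:~R - 1 / 2) ^+ (2 * k).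
Proof.
rewrite /head_energy /tail_energy subrK intrB real_normK ?num_real //.
have -> : n%:~R - 1%:~R + 1 / 2 = n%:~R - 1 / 2 :> R by field.
have := cross_term_int_edge n; lra.
Qed.

(** By [gamma_sumE] the left-hand side is u(n)^2 times the bracket in which the
total factor of g(n) is at its largest possible value, 2 - 1/(4 n^2). *)
Lemma vertex_energy_ge (n : int) :
  \sum_(1 <= i < k.+1)
     gamma R k i * (`|u n| ^+ 2 * n%:~R ^+ (2 * k - 2 * i))
  + 2 ^- (2 * k + 2) * (`|u n| ^+ 2 / n%:~R ^+ 2) <=
  head_energy n + tail_energy n.
Proof.
have [->|n0] := eqVneq n 0.
  rewrite /head_energy /tail_energy u0 normr0 expr0n /= !(mulr0, mul0r).
  by rewrite big1 ?addr0 // => i _; rewrite !mul0r mulr0.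
have nR0 : n%:~R != 0 :> R by rewrite intr_eq0.
rewrite real_normK ?num_real //.
under eq_bigr do rewrite mulrCA.
rewrite -mulr_sumr mulrCA -mulrDr gamma_sumE //.
rewrite /head_energy /tail_energy -mulrDl [leRHS]mulrC.
apply: ler_wpM2l; first exact: sqr_ge0.
have := ler_wpM2r (ltW (quarter_pow_gt0 k n%:~R)) (weights_le n0); lra.
Qed.
End HardyEdges.

(** * Summation over all edges *)

Unset Implicit Arguments.

Theorem theorem2p1 (R : realType) (u : int -> R)
    (hu : finitely_supported u) (hu0 : u 0 = 0)
    (k : nat) (hk : (0 < k)%N) :
  (forall i : nat, (1 <= i <= k)%N -> 0 <= gamma R k i) /\
  \sum_(n \in [set: int])
      `|u n - u (n - 1)| ^+ 2 * (n%:~R - 1 / 2) ^+ (2 * k)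
  >= \sum_(1 <= i < k.+1)
       gamma R k i *
       \sum_(n \in [set: int]) `|u n| ^+ 2 * n%:~R ^+ (2 * k - 2 * i)
     + 2 ^- (2 * k + 2) *
       \sum_(n \in ~` [set 0 : int]) `|u n| ^+ 2 / n%:~R ^+ 2.
Proof.
split; first by move=> i _; exact: gamma_ge0.
(* Outside A, which contains the support of u and its translate by 1, both u n
   and u (n - 1) vanish, so that all sums can be taken over A. *)
pose S := [set n : int | u n <> 0].
pose A : {fset int} := fset_set (S `|` [set n + 1 | n in S]).
have A_E n : n \notin A -> u n = 0 /\ u (n - 1) = 0.
  rewrite in_fset_set ?finite_setU; last by split=> //; exact: finite_image.
  rewrite notin_setE => nA; split; apply: contrapT => un0; apply: nA.
    by left.
  by right; exists (n - 1); rewrite ?subrK.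
have sumA (F : int -> R) : (forall n, u n = 0 -> F n = 0) ->
    \sum_(n \in [set: int]) F n = \sum_(n <- A) F n.
  by move=> F0; apply: fsbigTE => n /A_E[un0 _]; exact: F0.
have tail0 n : u n = 0 -> tail_energy k u n = 0.
  by rewrite /tail_energy => ->; rewrite expr0n mulr0.
have shift_bij : bijective (fun n : int => n - 1).
  by exists (fun n => n + 1) => n; rewrite ?subrK ?addrK.
have tail_shift : \sum_(n <- A) tail_energy k u (n - 1) =
    \sum_(n <- A) tail_energy k u n.
  rewrite -(sumA _ tail0) (reindex_fsbigT _ (tail_energy k u) shift_bij).
  by apply/esym/fsbigTE => n /A_E[_ /tail0].
rewrite (@fsbigTE _ _ _ _ A); last first.
  by move=> n /A_E[-> ->]; rewrite subrr normr0 expr0n mul0r.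
apply: le_trans (ler_sum _ (fun n _ => edge_energy_ge k hu0 n)).
rewrite big_split /= tail_shift -big_split /=.
apply: le_trans (ler_sum _ (fun n _ => vertex_energy_ge k hu0 n)).
rewrite big_split /= exchange_big /= -mulr_sumr le_eqVlt; apply/orP; left.
apply/eqP; congr (_ + _ * _).
  apply: eq_bigr => i _; rewrite -mulr_sumr sumA // => n ->.
  by rewrite normr0 expr0n mul0r.
rewrite (@fsbig_widen _ _ _ _ _ [set: int]) //.
  by apply: sumA => n ->; rewrite normr0 expr0n mul0r.
by move=> n [_ /contrapT ->] /=; rewrite hu0 normr0 expr0n mul0r.
Qed.
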